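(* Let $f:\mathbb{R}^d\to\mathbb{R}$ be differentiable, bounded from below and $L$-smooth. Let $\mathcal{D}$ be a probability distribution on $\mathbb{R}^d$ such that (i) $\mathbb{E}_{s\sim\mathcal{D}}[\|s\|_2^2]<\infty$; (ii) there are a norm $\|\cdot\|_{\mathcal{D}}$ on $\mathbb{R}^d$ and a constant $\mu_{\mathcal{D}}>0$ with $\mathbb{E}_{s\sim\mathcal{D}}|\langle v,s\rangle|\ge\mu_{\mathcal{D}}\|v\|_{\mathcal{D}}$ for all $v\in\mathbb{R}^d$; (iii) $\mathbb{P}_{s\sim\mathcal{D}}(\|s\|_2\le 1)=1$. Let $\{\theta^t\}_{t\ge1}$ be generated by the Stochastic Three Points (STP) algorithm with (deterministic, positive) step sizes $\{\alpha_t\}_{t\ge1}$ satisfying $\sum_{t=1}^\infty\alpha_t^2<\infty$ and $\sum_{t=1}^\infty\alpha_t=\infty$. Then $$\lim_{T\to\infty}\|\nabla f(\theta^T)\|_{\mathcal{D}}=0\quad\text{almost surely.}$$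
   Context: $L$-smooth means $\|\nabla f(x)-\nabla f(y)\|_2\le L\|x-y\|_2$ for all $x,y\in\mathbb{R}^d$. STP algorithm: given a deterministic initial point $\theta^1\in\mathbb{R}^d$, step sizes $\alpha_t>0$ and the distribution $\mathcal{D}$, for $t=1,2,\ldots$ draw a random vector $s_t\sim\mathcal{D}$ (the $s_t$ being independent) and set $\theta^{t+1}\in\arg\min_{\theta\in\{\theta^t,\ \theta^t+\alpha_ts_t,\ \theta^t-\alpha_ts_t\}}f(\theta)$, with ties broken by a fixed measurable rule depending only on $(t,\theta^t,s_t)$. *)

(* Defs.v *)
From HB Require Import structures.
From mathcomp Require Import all_boot all_order all_algebra finmap.
From mathcomp Require Import all_classical all_reals all_analysis.

Set Implicit Arguments.
Unset Strict Implicit.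
Unset Printing Implicit Defensive.

Import Order.TTheory GRing.Theory Num.Theory.
Import numFieldNormedType.Exports.

Local Open Scope classical_set_scope.
Local Open Scope ring_scope.

(* R^d is 'rV[R]_d. Its library topology comes from the sup norm, which in
   finite dimension is equivalent to the Euclidean norm, so that [open],
   [differentiable] and the Borel sigma-algebra below are the usual ones. *)
Section borel_rV.
Variables (R : realType) (d : nat).

HB.instance Definition _ :=
  @isMeasurable.Build (sigma_display (@open 'rV[R]_d)) 'rV[R]_d
    <<s (@open 'rV[R]_d) >> (@sigma_algebra0 _ setT _) (@sigma_algebraC _ _)
    (@sigma_algebra_bigcup _ setT _).

End borel_rV.

Section euclidean.
Variables (R : realType) (d : nat).
Implicit Types (x y : 'rV[R]_d) (f : 'rV[R]_d -> R).

Definition inner x y : R := \sum_i x 0 i * y 0 i.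

(* The library norm on 'rV[R]_d is the sup norm, hence a separate definition. *)
Definition norm2 x : R := Num.sqrt (inner x x).

Definition gradient f x : 'rV[R]_d := \row_i 'D_(delta_mx 0 i) f x.

Definition smooth (L : R) f :=
  forall x y, norm2 (gradient f x - gradient f y) <= L * norm2 (x - y).

(* An arbitrary norm on R^d, as a function; the normed-module structures of the
   library would instead fix one canonical norm on the type. *)
Record is_norm (N : 'rV[R]_d -> R) : Prop := IsNorm {
  is_norm_ge0 : forall x, 0 <= N x ;
  is_norm_eq0 : forall x, N x = 0 -> x = 0 ;
  is_normZ : forall (a : R) x, N (a *: x) = `|a| * N x ;
  is_normD : forall x y, N (x + y) <= N x + N y }.

End euclidean.

Definition argmin (T : Type) (R : realType) (f : T -> R) (A : set T) : set T :=
  [set x | A x /\ forall y, A y -> f x <= f y].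

Definition mutually_independent (dO dT : measure_display)
    (Omega : measurableType dO) (T : measurableType dT) (R : realType)
    (P : probability Omega R) (I : choiceType) (X : I -> {RV P >-> T}) :=
  forall (J : {fset I}) (B : I -> set T), (forall i, measurable (B i)) ->
    P (\bigcap_(i in [set` J]) X i @^-1` B i) =
    (\prod_(i <- J) P (X i @^-1` B i))%E.

Section stp.
Variables (R : realType) (d : nat).
Implicit Types (f : 'rV[R]_d -> R) (alpha : nat -> R).

Definition stp_candidates (a : R) (x s : 'rV[R]_d) : set 'rV[R]_d :=
  [set x; x + a *: s; x - a *: s].

(* [rule t x s] is the minimizer selected at step t from the iterate x and the
   direction s: the argmin together with its tie-breaking. *)
Definition stp_rule f alpha (rule : nat -> 'rV[R]_d -> 'rV[R]_d -> 'rV[R]_d) :=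
  (forall t, measurable_fun [set: 'rV[R]_d * 'rV[R]_d]
     (fun z => rule t z.1 z.2)) /\
  (forall t x s, argmin f (stp_candidates (alpha t) x s) (rule t x s)).

(* Time is counted from 0: [theta 0] is the initial point, and [alpha t], [s t]
   and [rule t] produce [theta t.+1] from [theta t]. *)
Record is_stp f alpha (theta0 : 'rV[R]_d) (D : probability 'rV[R]_d R)
    (dO : measure_display) (Omega : measurableType dO)
    (P : probability Omega R) (s : nat -> {RV P >-> 'rV[R]_d})
    (theta : nat -> Omega -> 'rV[R]_d) : Prop := IsSTP {
  is_stp_law : forall t (B : set 'rV[R]_d), measurable B ->
    distribution P (s t) B = D B ;
  is_stp_indep : mutually_independent s ;
  is_stp_init : forall w, theta 0%N w = theta0 ;
  is_stp_step : exists2 rule, stp_rule f alpha rule &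
    forall t w, theta t.+1 w = rule t (theta t w) (s t w) }.

End stp.

(* Main.v *)
(** The best trial point satisfies
      f(theta^{t+1}) <= f(theta^t) - alpha_t |<grad f(theta^t), s_t>| + K alpha_t^2.
    Since theta^t depends only on the earlier directions, it is independent of
    s_t, so by Tonelli the expectation of the middle term is at least
    muD alpha_t E[normD (grad f(theta^t))].  As f is bounded below and the
    alpha_t^2 are summable, telescoping the expectations shows that
    sum_t alpha_t normD (grad f(theta^t)) has finite expectation, hence is
    almost surely finite.  By smoothness successive values of
    normD (grad f(theta^t)) differ by O(alpha_t), and a deterministic argument
    using sum_t alpha_t = oo and alpha_t -> 0 forces them to tend to 0. *)
From HB Require Import structures.
Require Import Defs.
From mathcomp Require Import all_boot all_order all_algebra finmap.
From mathcomp Require Import all_classical all_reals all_analysis measurable_realfun ring.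

Import Order.TTheory GRing.Theory Num.Theory.
Import numFieldNormedType.Exports.

Local Open Scope classical_set_scope.
Local Open Scope ring_scope.

(** * Inner product, Euclidean norm and comparison of norms *)

Section vectors.
Context {R : realType} {d : nat}.
Implicit Types (x y v : 'rV[R]_d) (f : 'rV[R]_d -> R) (N : 'rV[R]_d -> R).

Lemma innerZ (a : R) x y : inner x (a *: y) = a * inner x y.
Proof.
by rewrite /inner mulr_sumr; apply: eq_bigr => i _; rewrite mxE mulrCA.
Qed.

Lemma innerBl x y v : inner (x - y) v = inner x v - inner y v.
Proof.
by rewrite /inner -sumrB; apply: eq_bigr => i _; rewrite !mxE mulrBl.
Qed.

Lemma norm2Z (a : R) x : norm2 (a *: x) = `|a| * norm2 x.
Proof.
rewrite /norm2 innerZ -sqrtr_sqr -sqrtrM ?sqr_ge0//; congr (Num.sqrt _).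
rewrite expr2 -mulrA; congr (_ * _).
by rewrite /inner mulr_sumr; apply: eq_bigr => i _; rewrite mxE mulrA.
Qed.

Lemma norm2_ge0 x : 0 <= norm2 x. Proof. exact: sqrtr_ge0. Qed.

Lemma abs_coord_le_norm2 x i : `|x 0 i| <= norm2 x.
Proof.
rewrite -sqrtr_sqr ler_wsqrtr// /inner (bigD1 i)//= expr2 lerDl.
by apply: sumr_ge0 => j _; rewrite -expr2 sqr_ge0.
Qed.

Lemma abs_coord_le_normr x i : `|x 0 i| <= `|x|.
Proof.
rewrite [leRHS]/Num.norm/= mx_normrE; apply/bigmax_geP; right => /=.
by exists (0, i).
Qed.

Lemma norm2_le_normr x : norm2 x <= d%:R * `|x|.
Proof.
rewrite -(ger0_norm (mulr_ge0 (ler0n R d) (normr_ge0 x))) -sqrtr_sqr.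
rewrite ler_wsqrtr// /inner.
apply: (@le_trans _ _ (\sum_(i < d) `|x| ^+ 2)).
  apply: ler_sum => i _; rewrite -expr2 -(real_normK (num_real (x 0 i))).
  by rewrite lerXn2r ?nnegrE// abs_coord_le_normr.
rewrite sumr_const card_ord -[leLHS]mulr_natl exprMn ler_wpM2r ?sqr_ge0//.
by rewrite -natrX ler_nat; case: (d) => // n; rewrite leq_pmulr.
Qed.

(** A coordinatewise weak form of the Cauchy-Schwarz inequality; the factor [d] only enlarges
    constants later on. *)
Lemma abs_inner_le x y : `|inner x y| <= d%:R * (norm2 x * norm2 y).
Proof.
rewrite (le_trans (ler_norm_sum _ _ _))//.
apply: (@le_trans _ _ (\sum_(i < d) norm2 x * norm2 y)); last first.
  by rewrite sumr_const card_ord mulr_natl.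
by apply: ler_sum => i _; rewrite normrM ler_pM// abs_coord_le_norm2.
Qed.

(** Expand [x] in the canonical basis: homogeneity and the triangle inequality give for [K] the sum
    of the norms of the basis vectors. *)
Lemma is_norm_le_norm2 N : is_norm N ->
  exists2 K, 0 <= K & forall x, N x <= K * norm2 x.
Proof.
move=> hN; exists (\sum_i N (delta_mx 0 i)).
  by apply: sumr_ge0 => i _; exact: is_norm_ge0.
move=> x; rewrite {1}(row_sum_delta x) big_distrl/=.
have N0 : N 0 = 0 by rewrite -(scale0r 0) is_normZ// normr0 mul0r.
apply: (@le_trans _ _ (\sum_i N (x 0 i *: delta_mx 0 i))).
  elim/big_ind2 : _ => [|a b a' b' h h'|//]; first by rewrite N0.
  by rewrite (le_trans (is_normD hN _ _))// lerD.
apply: ler_sum => i _; rewrite is_normZ// mulrC ler_wpM2l ?(is_norm_ge0 hN)//.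
exact: abs_coord_le_norm2.
Qed.

Lemma is_norm_dist N x y : is_norm N -> `|N x - N y| <= N (x - y).
Proof.
move=> hN; have le_sub u v : N u - N v <= N (u - v).
  by rewrite lerBlDr -{1}(subrK v u) is_normD.
rewrite ler_norml le_sub andbT lerNl opprB.
by rewrite -[N (x - y)]mul1r -normrN1 -is_normZ// scaleN1r opprB.
Qed.

(** * Continuity and Borel measurability on R^d *)

Lemma lipschitz_norm2_continuous (g : 'rV[R]_d -> R) (C : R) : 0 <= C ->
  (forall x y, `|g x - g y| <= C * norm2 (x - y)) -> continuous g.
Proof.
move=> C0 gC x A /= /nbhs_normP[e /= e0 eA].
(* The [+ 1] keeps the divisor positive even when [C] or [d] is zero. *)
have D0 : 0 < C * d%:R + 1 by rewrite ltr_wpDl// mulr_ge0.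
apply/(@nbhs_normP R 'rV[R]_d); exists (e / (C * d%:R + 1)) => /=.
  exact: divr_gt0.
move=> y /= xy; apply: eA => /=; rewrite (le_lt_trans (gC _ _))//.
rewrite (le_lt_trans (ler_wpM2l C0 (norm2_le_normr _)))// mulrA.
apply: (@le_lt_trans _ _ ((C * d%:R + 1) * `|x - y|)).
  by rewrite ler_wpM2r// lerDl.
by rewrite mulrC -ltr_pdivlMr.
Qed.

Lemma continuous_measurable_rV (g : 'rV[R]_d -> R) :
  continuous g -> measurable_fun setT g.
Proof.
move=> /continuousP cg; apply: (measurability _ (RGenOpens.measurableE R)).
move=> _ [_ [a [b ->] <-]]; rewrite setTI; apply: sub_sigma_algebra.
exact/cg/interval_open.
Qed.

Lemma measurable_coord i : measurable_fun setT (fun v : 'rV[R]_d => v 0 i).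
Proof.
exact: (continuous_measurable_rV (fun v => v 0 i) (@coord_continuous _ _ _ 0 i)).
Qed.

(** The first argument is taken coordinatewise because measurability of the gradient is obtained one
    coordinate at a time. *)
Lemma measurable_inner dT (T : measurableType dT) (g h : T -> 'rV[R]_d) :
  (forall i, measurable_fun setT (fun t => g t 0 i)) ->
  measurable_fun setT h ->
  measurable_fun setT (fun t => inner (g t) (h t)).
Proof.
move=> mg mh; apply: measurable_sum => i; apply: measurable_funM => //.
exact: (measurableT_comp (measurable_coord i) mh).
Qed.

Lemma measurable_unit_ball : measurable [set v : 'rV[R]_d | norm2 v <= 1].
Proof.
have mi : measurable_fun setT (fun v : 'rV[R]_d => inner v v).
  apply: measurable_inner => // i.
  exact: measurable_coord.
have normE v : (norm2 v <= 1) = (inner v v <= 1).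
  by rewrite -[in LHS]sqrtr1 ler_sqrt.
have := mi measurableT _ (measurable_itv `]-oo, 1]).
rewrite setTI; congr measurable.
by apply/seteqP; split => v /=; rewrite in_itv/= normE.
Qed.

(** * Calculus for smooth functions *)

Lemma diff_gradient f x v : differentiable f x ->
  'd f x v = inner (gradient f x) v.
Proof.
move=> df; rewrite [in LHS](row_sum_delta v) linear_sum /inner.
by apply: eq_bigr => i _; rewrite linearZ/= !mxE deriveE// mulrC.
Qed.

(** The one-variable mean value theorem, applied to the restriction [phi] of [f] to the segment from
    [x] to [x + v]. *)
Lemma mean_value_segment f x v : (forall z, differentiable f z) ->
  exists2 c, 0 <= c <= 1 & f (x + v) - f x = inner (gradient f (x + c *: v)) v.
Proof.
move=> df.
pose phi (u : R) := f (x + u *: v).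
(* The difference quotients of [phi] at [u] are those of [f] at [x + u *: v] along [v]. *)
have phiE (u : R) : (fun h => h^-1 *: (phi (h *: 1 + u) - phi u)) =
    (fun h => h^-1 *: (f (h *: v + (x + u *: v)) - f (x + u *: v))).
  by apply/funext => h; rewrite /phi addrCA -scalerDl /GRing.scale/= mulr1.
have dphi (u : R) : is_derive u 1 phi (inner (gradient f (x + u *: v)) v).
  apply: DeriveDef.
    by rewrite /derivable phiE; exact: diff_derivable.
  by rewrite /derive phiE -diff_gradient// -deriveE.
have [|c] := @MVT_segment R phi _ 0 1 ler01 (fun u _ => dphi u).
  apply: continuous_subspaceT => u.
  by apply: differentiable_continuous; apply/derivable1_diffP.
rewrite in_itv/= subr0 mulr1 /phi scale1r scale0r addr0 => c01 ->.
by exists c.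
Qed.

Variables (f : 'rV[R]_d -> R) (L : R).
Hypotheses (df : forall z, differentiable f z) (fL : smooth L f).

(** Passing to [|L|] gives a nonnegative constant, whatever the sign of [L]. *)
Lemma smooth_dist x y : norm2 (gradient f x - gradient f y) <= `|L| * norm2 (x - y).
Proof. by rewrite (le_trans (fL _ _))// ler_wpM2r ?norm2_ge0// ler_norm. Qed.

(* The crude constant [d] (instead of 1/2) comes from [abs_inner_le]; its value
   is irrelevant for the convergence. *)
Lemma smooth_ascent x v :
  f (x + v) <= f x + inner (gradient f x) v + d%:R * `|L| * norm2 v ^+ 2.
Proof.
have [c /andP[c0 c1] /(canRL (subrK _)) ->] := mean_value_segment f x v df.
(* What remains is the change of the gradient between [x] and [x + c *: v], tested against [v]. *)
rewrite addrC -addrA lerD2l -lerBlDl -innerBl.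
rewrite (le_trans (ler_norm _))// (le_trans (abs_inner_le _ _))//.
rewrite -mulrA ler_wpM2l// expr2 mulrA ler_wpM2r ?norm2_ge0//.
rewrite (le_trans (smooth_dist _ _))// ler_wpM2l// addrAC subrr add0r norm2Z.
by rewrite ger0_norm// ler_piMl// norm2_ge0.
Qed.

Lemma measurable_gradient_coord i : measurable_fun setT (fun x => gradient f x 0 i).
Proof.
apply: continuous_measurable_rV.
apply: (lipschitz_norm2_continuous _ `|L|) => // x y.
apply: le_trans (smooth_dist _ _).
by have := abs_coord_le_norm2 (gradient f x - gradient f y) i; rewrite !mxE.
Qed.

Lemma continuous_norm_gradient N : is_norm N -> continuous (N \o gradient f).
Proof.
move=> hN; have [K K0 NK] := is_norm_le_norm2 _ hN.
apply: (lipschitz_norm2_continuous _ (K * `|L|)); first exact: mulr_ge0.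
move=> x y; rewrite (le_trans (is_norm_dist _ _ _ hN))// (le_trans (NK _))//.
by rewrite -mulrA ler_wpM2l// smooth_dist.
Qed.

End vectors.

(** * A deterministic convergence criterion *)

(** Since the weights [a] have infinite sum, [g] must become small at arbitrarily late indices.
    Climbing back up would take many steps with [g] bounded below, and these use up the tail of the
    convergent series. *)
Lemma cvg0_weighted_series (R : realType) (a g : R^nat) (C : R) :
  (forall t, 0 <= a t) -> (forall t, 0 <= g t) ->
  a @ \oo --> 0 -> (\sum_(0 <= t <oo) (a t)%:E = +oo)%E ->
  (\sum_(0 <= t <oo) (a t * g t)%:E < +oo)%E ->
  (forall t, g t.+1 <= g t + C * a t) -> g @ \oo --> 0.
Proof.
move=> a0 g0 acvg asum agsum gstep.
pose S := series (fun t => a t * g t).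
have Scvg : cvgn S by apply: nnseries_is_cvg => // i; exact: mulr_ge0.
have SS n : S n.+1 = S n + a n * g n by rewrite /S /series/= big_nat_recr.
have Snd : nondecreasing_seq S.
  by apply/nondecreasing_seqP => n; rewrite SS lerDl mulr_ge0.
have S_le n : S n <= limn S := nondecreasing_cvgn_le Snd Scvg n.
pose K := `|C| + 1.
have K0 : 0 < K by rewrite ltr_wpDl.
have gK t : g t.+1 <= g t + K * a t.
  rewrite (le_trans (gstep t))// lerD2l ler_wpM2r//.
  by rewrite (le_trans (ler_norm C))// lerDl.
(* The three thirds pay for the starting level, for one step across that level, and for the tail of
   [S]. *)
apply/cvgr0Pnorm_le => e e0; pose h := e / 3%:R.
have h0 : 0 < h by rewrite divr_gt0.
have [hK0 Kh0] : 0 <= h / K /\ 0 <= K / h by rewrite !divr_ge0// ltW.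
(* With this tolerance [K / h] times the tail is at most [h]; the next one bounds a single increment
   [K * a n] by [h]. *)
have [N1 _ N1P] : \forall n \near \oo, `|limn S - S n| <= h * h / K.
  by move/cvgrPdist_le : Scvg; apply; rewrite divr_gt0// mulr_gt0.
have [N2 _ N2P] : \forall n \near \oo, `|a n| <= h / K.
  by move/cvgr0Pnorm_le : acvg; apply; rewrite divr_gt0.
pose N := maxn N1 N2.
(* Were [g] above [h] from [N] on, each [a t] would be at most [h^-1 * (a t * g t)], and the sum of
   the [a t] would be finite. *)
have [m Nm gm] : exists2 m, (N <= m)%N & g m <= h.
  apply: contrapT => noM.
  have gN n : (N <= n)%N -> h <= g n.
    by move=> Nn; rewrite leNgt; apply/negP => /ltW gn; apply: noM; exists n.
  suff : (\sum_(0 <= t <oo) (a t)%:E <= (series a N + h^-1 * limn S)%:E)%E.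
    by rewrite asum leye_eq.
  apply: lime_le; first by apply: is_cvg_nneseries => n _ _; rewrite lee_fin.
  near=> n; have Nn : (N <= n)%N by near: n; exact: nbhs_infty_ge.
  rewrite sumEFin lee_fin (big_cat_nat (leq0n N) Nn)//= lerD2l.
  apply: (@le_trans _ _ (h^-1 * \sum_(N <= i < n) a i * g i)).
    rewrite mulr_sumr ler_sum_nat// => i /andP[Ni _].
    by rewrite mulrCA ler_peMr// mulrC ler_pdivlMr// mul1r gN.
  rewrite ler_wpM2l ?invr_ge0 ?(ltW h0)//; apply: le_trans (S_le n).
  rewrite [leRHS]/S /series/= (big_cat_nat (leq0n N) Nn)//= lerDr.
  by apply: sumr_ge0 => i _; exact: mulr_ge0.
(* While [g] stays above [h], the increment [K * a t] is at most
   [K / h * (a t * g t)], hence is paid for by the convergent series. *)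
have gmn n : g (m + n)%N <= h + K * (h / K) + K / h * (S (m + n)%N - S m).
  elim: n => [|n IH].
    by rewrite addn0 subrr mulr0 addr0 (le_trans gm)// lerDl mulr_ge0// ltW.
  rewrite addnS SS; set k := (m + n)%N in IH *.
  have [gk|gk] := leP (g k) h.
    (* Starting at or below [h], one step adds at most [K * (h / K)], since [k] is at least [N2]. *)
    apply: (le_trans (gK k)); rewrite -addrA lerD// -[leLHS]addr0 lerD//.
      rewrite ler_wpM2l ?(ltW K0)// (le_trans (ler_norm _))// N2P//=.
      by rewrite (leq_trans (leq_maxr N1 N2))// (leq_trans Nm)// leq_addr.
    rewrite mulr_ge0// subr_ge0 -SS Snd//.
    by rewrite leqW// leq_addr.
  apply: (le_trans (gK k)); rewrite [X in K / h * X]addrAC mulrDr addrA lerD//.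
  rewrite -mulrA ler_wpM2l ?(ltW K0)// mulrCA ler_peMr//.
  by rewrite mulrC ler_pdivlMr// mul1r ltW.
exists m => // n /= mn; rewrite ger0_norm// -(subnKC mn).
apply: le_trans (gmn _) _.
have -> : e = h + K * (h / K) + K / h * (h * h / K).
  have [hn Kn] : h != 0 /\ K != 0 by rewrite !gt_eqF.
  have -> : e = h * 3%:R by rewrite /h divfK.
  by field; rewrite hn Kn.
rewrite lerD2l ler_wpM2l//.
have Sm : limn S - S m <= h * h / K.
  rewrite (le_trans (ler_norm _))// N1P//=.
  by rewrite (leq_trans (leq_maxl N1 N2)).
by apply: le_trans Sm; rewrite lerD2r S_le.
Unshelve. all: by end_near. Qed.

(** * Independence of the current iterate from the directions still to come *)

Section independence.
Context {dO : measure_display} {Omega : measurableType dO} {R : realType}.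
Variable P : probability Omega R.

(** Both sides are finite measures in [C]. They agree on measurable rectangles, a generating class
    stable under intersection, hence everywhere. *)
Lemma independent_event_pair d1 d2 (T1 : measurableType d1)
    (T2 : measurableType d2) (X : Omega -> T1) (Y : Omega -> T2) (E : set Omega) :
  measurable_fun setT X -> measurable_fun setT Y -> measurable E ->
  (forall A B, measurable A -> measurable B ->
    P (X @^-1` A `&` Y @^-1` B `&` E) =
    (P (X @^-1` A `&` Y @^-1` B) * P E)%E) ->
  forall C, measurable C ->
    P ((fun w => (X w, Y w)) @^-1` C `&` E) =
    (P ((fun w => (X w, Y w)) @^-1` C) * P E)%E.
Proof.
move=> mX mY mE XYE C mC.
have mXY := measurable_fun_pair mX mY.
pose Z : {mfun Omega >-> (T1 * T2)%type} :=
  HB.pack (fun w => (X w, Y w)) (isMeasurableFun.Build _ _ _ _ _ mXY).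
pose p := NngNum (fine_ge0 (measure_ge0 P E)).
pose m1 := pushforward (mrestr P mE) Z.
pose m2 := pushforward (mscale p P) Z.
have m2E A : m2 A = (P (Z @^-1` A) * P E)%E.
  by rewrite /m2 /pushforward /mscale/= fineK ?fin_num_measure// muleC.
rewrite -[RHS](m2E C) -[LHS]/(m1 C).
apply: (@measure_unique _ _ _ [set A `*` B | A in measurable & B in measurable]
  (fun=> setT) (measurable_prod_measurableType _ _)) => //.
- move=> _ _ [A mA [B mB <-]] [A' mA' [B' mB' <-]].
  exists (A `&` A'); first exact: measurableI.
  by exists (B `&` B'); [exact: measurableI | rewrite setXI].
- by exists setT => //; exists setT => //; rewrite setXTT.
- by rewrite bigcup_const.
- move=> _ [A mA [B mB <-]]; rewrite [RHS]m2E.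
  exact: XYE.
- move=> _; rewrite (@le_lt_trans _ _ 1%E) ?ltry//.
  by apply: probability_le1; apply: measurableI; rewrite ?preimage_setT.
Qed.

(** The factorization on rectangles identifies the law of [(X, Y)] with the product of the law of
    [X] and [D]; Tonelli then integrates [Y] out. *)
Lemma ge0_integral_independent_pair d1 d2 (T1 : measurableType d1)
    (T2 : measurableType d2) (X : Omega -> T1) (Y : Omega -> T2)
    (D : probability T2 R) (h : T1 * T2 -> \bar R) :
  measurable_fun setT X -> measurable_fun setT Y ->
  (forall A B, measurable A -> measurable B ->
    P (X @^-1` A `&` Y @^-1` B) = (P (X @^-1` A) * D B)%E) ->
  measurable_fun setT h -> (forall z, 0 <= h z)%E ->
  (\int[P]_w h (X w, Y w) = \int[P]_w \int[D]_y h (X w, y))%E.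
Proof.
move=> mX mY XYD mh h0.
have mXY := measurable_fun_pair mX mY.
pose X' : {mfun Omega >-> T1} :=
  HB.pack X (isMeasurableFun.Build _ _ _ _ _ mX).
pose Z : {mfun Omega >-> (T1 * T2)%type} :=
  HB.pack (fun w => (X w, Y w)) (isMeasurableFun.Build _ _ _ _ _ mXY).
have -> : (\int[P]_w h (X w, Y w) = \int[distribution P Z]_z h z)%E.
  by rewrite ge0_integral_pushforward.
have -> : (\int[distribution P Z]_z h z =
           \int[(distribution P X' \x D)%E]_z h z)%E.
  apply: eq_measure_integral => A mA _; symmetry.
  by apply: product_measure_unique => // B C mB mC; exact: XYD.
rewrite fubini_tonelli1//= ge0_integral_pushforward//.
- exact: measurable_fun_fubini_tonelli_F.
- by move=> x _; apply: integral_ge0.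
Qed.

(* The events on all directions still to be drawn, not just the next one, make
   the statement inductive. *)
Lemma iterates_independent d1 d2 (T1 : measurableType d1)
    (T2 : measurableType d2) (s : nat -> {RV P >-> T2})
    (step : nat -> T1 * T2 -> T1) (x0 : T1) (X : nat -> Omega -> T1) :
  mutually_independent s -> (forall t, measurable_fun setT (step t)) ->
  (forall w, X 0 w = x0) -> (forall t w, X t.+1 w = step t (X t w, s t w)) ->
  forall t, measurable_fun setT (X t) /\
    forall (A : set T1) (J : {fset nat}) (B : nat -> set T2),
    measurable A -> (forall i, measurable (B i)) ->
    (forall i, i \in J -> (t <= i)%N) ->
    P (X t @^-1` A `&` \bigcap_(i in [set` J]) s i @^-1` B i) =
    (P (X t @^-1` A) * P (\bigcap_(i in [set` J]) s i @^-1` B i))%E.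
Proof.
move=> s_indep mstep X0 XS.
have ms i B : measurable B -> measurable (s i @^-1` B).
  by move=> mB; exact: measurable_funPTI.
have mJ (J : {fset nat}) B : (forall i, measurable (B i)) ->
    measurable (\bigcap_(i in [set` J]) s i @^-1` B i).
  by move=> mB; apply: fin_bigcap_measurable => // i _; exact: ms.
elim=> [|t [mXt IH]].
  split; first by rewrite (_ : X 0 = cst x0)//; apply/funext.
  (* [X 0] is constant, so its events are either the whole space or empty. *)
  move=> A J B mA mB _; have [x0A|x0A] := pselect (A x0).
    have -> : X 0 @^-1` A = setT.
      by apply/seteqP; split => // w _ /=; rewrite X0.
    by rewrite setTI probability_setT mul1e.
  have -> : X 0 @^-1` A = set0.
    by apply/seteqP; split => // w /=; rewrite X0.
  by rewrite set0I measure0 mul0e.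
have mXst := measurable_fun_pair mXt (measurable_funPT (s t)).
have XSE : X t.+1 = step t \o (fun w => (X t w, s t w)).
  by apply/funext => w; rewrite XS.
split; first by rewrite XSE; exact: measurableT_comp.
(* [X t.+1] is a function of the pair [(X t, s t)], so rectangles for this pair suffice. *)
move=> A J B mA mB tJ; rewrite XSE comp_preimage.
apply: independent_event_pair => //; last first.
- by rewrite -[X in measurable X]setTI; exact: mstep.
- move=> A' B' mA' mB'.
  (* The condition on [s t] joins the family as index [t], so the induction hypothesis applies to
     [t] together with [J]. *)
  pose B'' i := if i == t then B' else B i.
  have mB'' i : measurable (B'' i) by rewrite /B''; case: ifP.
  have tnJ : t \notin J by apply/negP => /tJ; rewrite ltnn.
  have B''J i : i \in J -> B'' i = B i.
    by rewrite /B''; case: eqP => // ->; rewrite (negbTE tnJ).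
  have capJ : \bigcap_(i in [set` (t |` J)%fset]) s i @^-1` B'' i =
      s t @^-1` B' `&` \bigcap_(i in [set` J]) s i @^-1` B i.
    apply/seteqP; split => w.
      move=> h; split; first by have := h t; rewrite /= fset1U1 /B'' eqxx; exact.
      by move=> i /= iJ; have := h i; rewrite /= fset1Ur// B''J//; exact.
    move=> [ht h] i; rewrite /= => /fset1UP[->|iJ].
      by rewrite /B'' eqxx.
    by rewrite B''J//; exact: h.
  have capt : \bigcap_(i in [set` [fset t]%fset]) s i @^-1` B'' i = s t @^-1` B'.
    apply/seteqP; split => w.
      by move=> h; have := h t; rewrite /= inE eqxx /B'' eqxx; exact.
    by move=> ht i; rewrite /= => /fset1P ->; rewrite /B'' eqxx.
  have st_J : P (s t @^-1` B' `&` \bigcap_(i in [set` J]) s i @^-1` B i) =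
      (P (s t @^-1` B') * P (\bigcap_(i in [set` J]) s i @^-1` B i))%E.
    rewrite -capJ (s_indep _ _ mB'') big_fsetU1//= (s_indep _ _ mB).
    rewrite {1}/B'' eqxx; congr (_ * _)%E.
    by apply: eq_big_seq => i iJ; rewrite B''J.
  (* The induction hypothesis is used for [t] with [J] to split off [X t], then for [t] alone to
     reassemble the pair. *)
  rewrite -setIA -capJ IH//; last first.
    by move=> i /fset1UP[->//|/tJ/ltnW].
  rewrite capJ st_J muleA -capt IH// => i.
  by move=> /fset1P ->.
- exact: mJ.
Qed.

End independence.

(** * Finiteness of series and almost sure events *)

(** Telescoping written with sums only, so that no difference of infinite values occurs; the term
    [u n] is dropped by nonnegativity. *)
Lemma nneseries_descent_lty (R : realType) (u v c : nat -> \bar R) :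
  (forall t, 0 <= u t)%E -> (forall t, 0 <= v t)%E -> (forall t, 0 <= c t)%E ->
  (forall t, u t.+1 + v t <= u t + c t)%E -> (u 0%N < +oo)%E ->
  (\sum_(0 <= t <oo) c t < +oo)%E -> (\sum_(0 <= t <oo) v t < +oo)%E.
Proof.
move=> u0 v0 c0 uvc u_oo c_oo.
have partial n : (u n + \sum_(0 <= t < n) v t <= u 0%N + \sum_(0 <= t < n) c t)%E.
  elim: n => [|n IH]; first by rewrite !big_geq.
  rewrite !big_nat_recr//= (addeA (u 0%N)).
  by apply: le_trans (leeD2r _ IH); rewrite addeCA addeAC addeC leeD2r.
apply: (@le_lt_trans _ _ (u 0%N + \sum_(0 <= t <oo) c t)%E); last first.
  by rewrite lte_add_pinfty.
apply: lime_le; first by apply: is_cvg_nneseries => n _ _.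
near=> n; apply: le_trans (_ : u n + \sum_(0 <= t < n) v t <= _)%E.
  by rewrite leeDr.
rewrite (le_trans (partial n))// leeD2l//.
by apply: nneseries_lim_ge => k _ _.
Unshelve. all: by end_near. Qed.

(** Sum and integral commute for nonnegative terms, so the sum is integrable and therefore almost
    everywhere finite. *)
Lemma ae_nneseries_lty d (T : measurableType d) (R : realType)
    (mu : {measure set T -> \bar R}) (h : nat -> T -> \bar R) :
  (forall n, measurable_fun setT (h n)) -> (forall n x, 0 <= h n x)%E ->
  (\sum_(0 <= n <oo) \int[mu]_x h n x < +oo)%E ->
  {ae mu, forall x, (\sum_(0 <= n <oo) h n x < +oo)%E}.
Proof.
move=> mh h0 h_oo.
have sum0 x : (0 <= \sum_(0 <= n <oo) h n x)%E by exact: nneseries_ge0.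
have hint : mu.-integrable setT (fun x => \sum_(0 <= n <oo) h n x)%E.
  apply/integrableP; split; first exact: (ge0_emeasurable_sum (P := xpredT)).
  under eq_integral do rewrite gee0_abs//.
  by rewrite integral_nneseries.
apply: filterS (integrable_ae measurableT hint) => x /(_ I).
by rewrite ge0_fin_numE.
Qed.

Lemma ae_all_probability1 d (T : measurableType d) (R : realType)
    (P : probability T R) (A : nat -> set T) :
  (forall n, measurable (A n)) -> (forall n, P (A n) = 1%E) ->
  {ae P, forall x, forall n, A n x}.
Proof.
move=> mA PA; apply: ae_foralln => n; exists (~` A n); split => //.
- exact: measurableC.
- by have := probability_setC P (mA n); rewrite PA subee.
Qed.

(** * One step of the algorithm along a direction in the unit ball *)

Section stp_step.
Context {R : realType} {d : nat}.
Variables (f : 'rV[R]_d -> R) (L : R).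
Hypotheses (df : forall z, differentiable f z) (fL : smooth L f).
Variables (a : R) (x v y : 'rV[R]_d).
Hypotheses (a0 : 0 <= a) (v1 : norm2 v <= 1).
Hypothesis xy : argmin f (stp_candidates a x v) y.

(* The better of the two trial points moves against the sign of the slope
   along [v], which produces the absolute value. *)
Lemma stp_descent :
  f y + a * `|inner (gradient f x) v| <= f x + d%:R * `|L| * a ^+ 2.
Proof.
(* The sign [e] treats both trial points at once; [v] being in the unit ball bounds the quadratic
   term by [a ^+ 2]. *)
have trial e : `|e| = 1 -> f y <= f (x + (e * a) *: v) ->
    f y - e * a * inner (gradient f x) v <= f x + d%:R * `|L| * a ^+ 2.
  move=> e1 fy; rewrite lerBlDr (le_trans fy)//.
  rewrite (le_trans (smooth_ascent f L df fL _ _))//.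
  rewrite innerZ addrAC lerD2r lerD2l ler_wpM2l ?mulr_ge0//.
  rewrite norm2Z normrM e1 mul1r ger0_norm// exprMn ler_piMr ?sqr_ge0//.
  by rewrite exprn_ile1 ?norm2_ge0.
have [inner_ge0|inner_lt0] := leP 0 (inner (gradient f x) v).
  have := trial (-1); rewrite normrN1 !mulN1r mulNr opprK scaleNr.
  by rewrite (ger0_norm inner_ge0); apply => //; apply: xy.2; right.
have := trial 1; rewrite normr1 mul1r => /(_ erefl).
by rewrite (ltr0_norm inner_lt0) mulrN; apply => //; apply: xy.2; left; right.
Qed.

Lemma stp_move : norm2 (y - x) <= a.
Proof.
have av : norm2 (a *: v) <= a by rewrite norm2Z ger0_norm// ler_piMr.
have [[->|->]|->] := xy.1.
- by rewrite subrr -(scale0r 0) norm2Z normr0 mul0r.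
- by rewrite addrAC subrr add0r.
- by rewrite addrAC subrr add0r -scaleN1r norm2Z normrN1 mul1r.
Qed.

End stp_step.

(** * Almost sure convergence of the gradient norms *)

Theorem theorem2 (R : realType) (d : nat)
    (f : 'rV[R]_d -> R) (L : R)
    (D : probability 'rV[R]_d R) (normD : 'rV[R]_d -> R) (muD : R)
    (alpha : nat -> R) (theta0 : 'rV[R]_d)
    (dO : measure_display) (Omega : measurableType dO) (P : probability Omega R)
    (s : nat -> {RV P >-> 'rV[R]_d}) (theta : nat -> Omega -> 'rV[R]_d)
    (f_diff : forall x : 'rV[R]_d, differentiable f x)
    (f_bounded_below : has_lbound (range f))
    (f_smooth : smooth L f)
    (D_moment2 : ('E_D[(fun v => norm2 v ^+ 2)%R] < +oo)%E)
    (normD_norm : is_norm normD)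
    (muD_gt0 : 0 < muD)
    (D_lower : forall v : 'rV[R]_d,
       ((muD * normD v)%R%:E <= 'E_D[(fun u => `|inner v u|)%R])%E)
    (D_unit : D [set v | norm2 v <= 1] = 1%E)
    (alpha_gt0 : forall t, 0 < alpha t)
    (alpha_sq_sum : (\sum_(0 <= t <oo) (alpha t ^+ 2)%:E < +oo)%E)
    (alpha_sum : (\sum_(0 <= t <oo) (alpha t)%:E = +oo)%E)
    (theta_stp : is_stp f alpha theta0 D s theta) :
  {ae P, forall w, normD (gradient f (theta T w)) @[T --> \oo] --> (0 : R)}.
Proof.
have [s_law s_indep theta_init [rule [mrule rule_argmin] theta_step]] := theta_stp.
have [m f_ge_m] := f_bounded_below.
have [C C0 normD_le] := is_norm_le_norm2 normD normD_norm.
pose K := d%:R * `|L|.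
have K0 : 0 <= K by exact: mulr_ge0.
have a0 t : 0 <= alpha t := ltW (alpha_gt0 t).
have norm0 v : 0 <= normD v := is_norm_ge0 normD_norm v.
have norm_ge0 t w : 0 <= muD * (alpha t * normD (gradient f (theta t w))).
  by rewrite !mulr_ge0// ltW.
have indep := iterates_independent P _ _ _ _ s (fun t z => rule t z.1 z.2) theta0 theta
  s_indep mrule theta_init theta_step.
have mtheta t : measurable_fun setT (theta t) by have [] := indep t.
have ms t : measurable_fun setT (s t) := measurable_funPT (s t).
have theta_s_indep t A B : measurable A -> measurable B ->
    P (theta t @^-1` A `&` s t @^-1` B) = (P (theta t @^-1` A) * D B)%E.
  (* Only the direction drawn at time [t] is kept among the future ones. *)
  move=> mA mB; have [_ /(_ A [fset t]%fset (fun=> B) mA)] := indep t.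
  rewrite set_fset1 bigcap_set1 -(s_law t B mB); apply => // i.
  by move=> /fset1P ->.
have mf : measurable_fun setT f.
  apply: continuous_measurable_rV => x.
  exact: differentiable_continuous.
(* Subtracting the lower bound [m] makes the expectations of nonnegative functions meaningful before
   any integrability is known. *)
pose u t w := (f (theta t w) - m)%:E.
have u0 t w : (0 <= u t w)%E by rewrite lee_fin subr_ge0 f_ge_m//; exists (theta t w).
have mu_ t : measurable_fun setT (u t).
  apply/measurable_EFinP; apply: measurable_funB => //.
  exact: measurableT_comp.
pose slope t (z : 'rV[R]_d * 'rV[R]_d) := (alpha t * `|inner (gradient f z.1) z.2|)%:E.
have slope0 t z : (0 <= slope t z)%E by rewrite lee_fin mulr_ge0.
have mslope_inner : measurable_fun setT
    (fun z : 'rV[R]_d * 'rV[R]_d => inner (gradient f z.1) z.2).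
  apply: measurable_inner => // i.
  exact: (measurableT_comp (measurable_gradient_coord f L f_smooth i)).
have mslope t : measurable_fun setT (slope t).
  apply/measurable_EFinP; apply: measurable_funM => //.
  exact: measurableT_comp.
pose g t w := (muD * (alpha t * normD (gradient f (theta t w))))%:E.
have mnorm : measurable_fun setT (normD \o gradient f).
  apply: continuous_measurable_rV.
  exact: (continuous_norm_gradient f L f_smooth normD normD_norm).
have mg t : measurable_fun setT (g t).
  apply/measurable_EFinP; do 2 apply: measurable_funM => //.
  exact: (measurableT_comp mnorm).
have s_unit : {ae P, forall w, forall t, norm2 (s t w) <= 1}.
  have mball := @measurable_unit_ball R d.
  apply: (ae_all_probability1 _ _ _ P
    (fun t => s t @^-1` [set v | norm2 v <= 1])) => t.
  - by rewrite -[X in measurable X]setTI; exact: ms.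
  - by rewrite -D_unit -(s_law t _ mball).
have slope_ge t : (\int[P]_w g t w <= \int[P]_w slope t (theta t w, s t w))%E.
  (* Integrating the direction out with the iterate frozen makes [D_lower] applicable at each value
     of the gradient. *)
  rewrite (ge0_integral_independent_pair P _ _ _ _ _ _ D (slope t))//; last first.
    exact: theta_s_indep.
  apply: ge0_le_integral => //.
  - by move=> w _; rewrite lee_fin.
  - have mF := @measurable_fun_fubini_tonelli_F _ _ _ _ _ D _ (mslope t) (slope0 t).
    exact: (measurableT_comp mF).
  - move=> w _; under eq_integral do rewrite /slope/= EFinM.
    rewrite ge0_integralZl_EFin//; last first.
      have minner : measurable_fun setT (fun v => inner (gradient f (theta t w)) v).
        by apply: measurable_inner => // i; exact: measurable_cst.
      by apply/measurable_EFinP; exact: measurableT_comp.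
    rewrite /g mulrCA EFinM lee_wpmul2l ?lee_fin//.
    by have := D_lower (gradient f (theta t w)); rewrite unlock.
have descent t : (\int[P]_w u t.+1 w + \int[P]_w g t w <=
    \int[P]_w u t w + (K * alpha t ^+ 2)%:E)%E.
  have mst : measurable_fun setT (fun w => slope t (theta t w, s t w)).
    by apply: (measurableT_comp (mslope t)); exact: measurable_fun_pair.
  apply: le_trans (leeD2l _ (slope_ge t)) _.
  rewrite -ge0_integralD//.
  have Kt0 : 0 <= K * alpha t ^+ 2 by rewrite mulr_ge0 ?sqr_ge0.
  have -> : (K * alpha t ^+ 2)%:E = (\int[P]_w (cst (K * alpha t ^+ 2)%:E w))%E.
    by rewrite integral_cst//= probability_setT mule1.
  (* The pointwise descent holds only where all directions lie in the unit ball, hence the almost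
     everywhere comparison. *)
  rewrite -ge0_integralD//; apply: ae_ge0_le_integral => //.
  - by move=> w _; exact: adde_ge0.
  - exact: emeasurable_funD.
  - by move=> w _; rewrite adde_ge0// lee_fin.
  - exact: emeasurable_funD.
  apply: filterS s_unit => w s1 _; rewrite /u /slope -!EFinD lee_fin.
  rewrite addrAC [leRHS]addrAC lerD2r theta_step.
  exact: (stp_descent f L f_diff f_smooth _ _ _ _ (a0 t) (s1 t)
    (rule_argmin t _ _)).
have g_sum : (\sum_(0 <= t <oo) \int[P]_w g t w < +oo)%E.
  apply: (nneseries_descent_lty _ (fun t => \int[P]_w u t w)%E _
    (fun t => (K * alpha t ^+ 2)%:E) _ _ _ descent).
  - by move=> t; exact: integral_ge0.
  - by move=> t; apply: integral_ge0 => w _; rewrite lee_fin.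
  - by move=> t; rewrite lee_fin mulr_ge0 ?sqr_ge0.
  (* The deterministic starting point makes the initial expectation finite. *)
  - under eq_integral do rewrite /u theta_init.
    by rewrite integral_cst//= probability_setT mule1 ltry.
  - under eq_eseriesr do rewrite EFinM.
    rewrite nneseriesZl; last by move=> t _; rewrite lee_fin sqr_ge0.
    by rewrite lte_mul_pinfty ?lee_fin.
have alpha_cvg : alpha @ \oo --> 0.
  have : series (fun t => alpha t ^+ 2) @ \oo --> limn (series (fun t => alpha t ^+ 2)).
    by apply: nnseries_is_cvg => // t; exact: sqr_ge0.
  move=> /cvgP/cvg_series_cvg_0/cvgr0Pnorm_le sq_cvg.
  apply/cvgr0Pnorm_le => e e0; have := sq_cvg _ (exprn_gt0 2 e0).
  apply: filterS => t; rewrite normrX.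
  by rewrite ler_pXn2r ?nnegrE// ltW.
apply: filterS2 s_unit (ae_nneseries_lty _ _ _ P g mg _ g_sum); last first.
  by move=> t w; rewrite lee_fin.
move=> w s1 gw_sum.
(* From here on the path is fixed. [C] compares [normD] with [norm2], and [|L|] is the Lipschitz
   constant of the gradient. *)
apply: (cvg0_weighted_series _ alpha _ (C * `|L|)) => //.
(* The summable series carries the factor [muD], whose positivity lets it be removed. *)
- rewrite ltNge leye_eq; apply/eqP => sum_oo; move: gw_sum.
  under eq_eseriesr do rewrite /g EFinM.
  rewrite nneseriesZl; last by move=> t _; rewrite lee_fin mulr_ge0.
  by rewrite sum_oo gt0_muley ?lte_fin// ltxx.
- move=> t; rewrite -lerBlDl (le_trans (ler_norm _))//.
  rewrite (le_trans (is_norm_dist _ _ _ normD_norm))//.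
  rewrite (le_trans (normD_le _))// -mulrA ler_wpM2l//.
  rewrite (le_trans (smooth_dist f L f_smooth _ _))// ler_wpM2l// theta_step.
  exact: (stp_move f _ _ _ _ (a0 t) (s1 t) (rule_argmin t _ _)).
Qed.
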